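(* Fix $\lambda>0$, $\epsilon>0$, $m\in\mathbb{N}$ and $b_1,\dots,b_m\in\{+1,-1\}$, and let the sets $\mathscr{B}_n$ of admissible dislocation configurations be defined from $\epsilon$ and $(b_i)$ as in the context. Let $\mathcal{G}$ be the Green's function on the dual lattice manifold complex described in the context. Then for all $n\in\mathbb{N}$ sufficiently large and for every $2$-form $\mu=\sum_{i=1}^m b_i(\mathbb{1}_{e_i}+\mathbb{1}_{e_i'})\in\mathscr{B}_n$, there exists a locally stable equilibrium $y_\mu\in\mathscr{V}_{\rm s}(\mathcal{M}_0)$ and an $\alpha\in[\boldsymbol{d}y_\mu]$ such that $$\boldsymbol{d}\alpha=\mu\quad\text{and}\quad\boldsymbol{\delta}\alpha=0 .$$ Furthermore, $\alpha^*=\boldsymbol{d}^*\mathcal{G}_{\mu^*}$, where $\mathcal{G}_{\mu^*}\in\mathscr{V}_{\rm s}(\mathcal{M}_0^* )$ is given by $$\mathcal{G}_{\mu^*}(e):=\sum_{i=1}^m b_i\,\mathcal{G}(e,e_i^* ).$$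
   Context: **Primal complex.** Let $\Lambda=\mathbb{Z}^2-(\tfrac12,\tfrac12)$, $\Gamma_0=\{(x_1,0):x_1\le 0\}$. The lattice manifold complex $\mathcal{M}$ consists of two copies (''branches'' $b=\pm1$) of the lattice glued along $\Gamma_0$; explicitly: - $0$-cells: $\mathcal{M}_0=\Lambda\times\{+1,-1\}$. The crack reflection of $a=((x,y),b)$ is $a'=((x,-y),-b)$. - $1$-cells: oriented edges $[a_1,a_2]$ (with $-[a_1,a_2]=[a_2,a_1]$) of two kinds: (i) $a_1,a_2$ on the same branch, with nearest-neighbour positions in $\Lambda$ and with the bond not crossing $\Gamma_0$; (ii) crossing edges joining $((-k-\tfrac12,\tfrac12),b)$ to $((-k-\tfrac12,-\tfrac12),-b)$, $k=0,1,2,\dots$, $b=\pm1$. - $2$-cells: oriented loops, being for each $l\in\mathbb{Z}^2\setminus\Gamma_0$ and $b=\pm1$ the four-edge loop around $l$ on branch $b$; for each $l=(-k,0)$, $k\ge1$, and $b=\pm1$ the four-edge loop through $((-k\pm\frac12,\frac12),b)$ and $((-k\pm\frac12,-\frac12),-b)$; and one central loop of eight edges through the eight $0$-cells $((\pm\frac12,\pm\frac12),\pm1)$. A $2$-cell is positively oriented if the loop is clockwise (after projection to $\mathbb{R}^2$). Crack reflection acts by $[a_1,a_2]'=[a_1',a_2']$ and likewise on loops (so it reverses clockwise/anticlockwise). $\mathcal{M}_p^{\pm}$ is the set of $p$-cells all of whose vertices lie on branch $\pm1$. **Forms.** $\mathscr{V}(\mathcal{M}_p)$ is the set of $f:\mathcal{M}_p\to\mathbb{R}$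 with $f(-e)=-f(e)$; a form may be specified by its values on positively oriented cells ($0$-forms are thus just functions on $\mathcal{M}_0$). $\mathscr{V}_{\rm s}(\mathcal{M}_p)=\{f\in\mathscr{V}(\mathcal{M}_p): f(e')=f(e)\ \forall e\}$; $\mathscr{V}_{\rm c}(\mathcal{M}_p)$ is its subspace of forms with compact support. $\|f\|_\infty=\sup_e|f(e)|$. Operators: $\boldsymbol{d}f([a_1,a_2])=f(a_2)-f(a_1)$ for $0$-forms; $\boldsymbol{d}\alpha(E)=\sum_{e\in\partial E}\alpha(e)$ (sum over the consistently oriented edges of the loop) for $1$-forms; $\boldsymbol{\delta}\alpha(a)=\sum_{[\tilde a,a]\in\mathcal{M}_1}\alpha([\tilde a,a])$. $\mathbb{1}_e(\tilde e)=\pm1$ if $\tilde e=\pm e$ and $0$ otherwise. $\|\beta\|_{\mathscr{L}^2(\mathcal{M}_1)}^2=\sum_{e\in\mathcal{M}_1}\beta(e)^2$. **Dual complex.** The dual cells are $\mathcal{M}^*_{2-p}=\{e^*:e\in\mathcal{M}_p\}$. The dual $0$-cells are located at $(\mathbb{Z}^2\times\{+1\})\cup((\mathbb{Z}^2\setminus\{(0,0)\})\times\{-1\})$: the dual of the positively oriented loop around $l\in\mathbb{Z}^2\setminus\Gamma_0$ on branch $b$ is the positively oriented $(l,b)$; the dual of the loop through $((-k\pm\frac12,\frac12),b)$, $((-k\pm\frac12,-\frac12),-b)$ is $((-k,0),b)$; that of the central loop is $((0,0),+1)$. The dual $e^*$ of a directed edge $e$ is the directed dual edge obtained by a right-hand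 (clockwise) turn, i.e. going from the dual $0$-cell of the $2$-cell on the left of $e$ to that on the right of $e$. Reflection: $(e^* )'=(e')^*$. Hence $f\in\mathscr{V}_{\rm s}(\mathcal{M}_0^* )$ (defined as for the primal complex), viewed as a function on positively oriented dual $0$-cells, satisfies $f((x,y),b)=-f((x,-y),-b)$ off $\Gamma_0$ and $f=0$ at all points of $\Gamma_0$. For a $p$-form $f$ on $\mathcal{M}$, $f^*(e^* ):=f(e)$. $\boldsymbol{d}^*$ and $\boldsymbol{\delta}^*$ are the corresponding differential and co-differential on the dual complex: $\boldsymbol{d}^*g$ of a directed dual edge is (value at end) minus (value at start), and $\boldsymbol{\delta}^*\beta$ at a dual $0$-cell is the sum of $\beta$ over incoming dual edges. **Distances.** $\omega(0)=0$ and $\omega(z)=\sqrt{r}(\cos\frac\theta2,\sin\frac\theta2)$ for $z=r(\cos\theta,\sin\theta)$, $\theta\in(-\pi,\pi]$. Each cell $e$ is identified with the subset $\chi(e)$ it occupies (a point; an open segment; an open square). For cells $e,\tilde e$ on the same branch, $D(e,\tilde e)=\inf|x-\tilde x|$ and $D_{\mathcal{W}}(e,\tilde e)=\inf|\omega(x)-\omega(\tilde x)|$ over $x\in\chi(e)$, $\tilde x\in\chi(\tilde e)$ (positions in $\mathbb{R}^2$); $|e|_{\mathcal{W}}=\inf_{x\in\chi(e)}|\omega(x)|$. **Admissible configurations.** $$\mathscr{B}_n=\Big\{\mu=\sum_{i=1}^m b_i(\mathbb{1}_{e_i}+\mathbb{1}_{e_i'}) : e_i\in\mathcal{M}_2^+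 \text{ positively oriented},\ \max\{D(e_i,e_j),D_{\mathcal{W}}(e_i,e_j)\}\ge\epsilon n\ \ \forall i\ne j\Big\}.$$ **Energy and equilibria.** $\psi(x)=\frac{\lambda}{2}\operatorname{dist}(x,\mathbb{Z})^2$ and $\mathcal{E}(y,\tilde y)=\sum_{e\in\mathcal{M}_1}\big(\psi(\boldsymbol{d}y(e))-\psi(\boldsymbol{d}\tilde y(e))\big)$. A $y\in\mathscr{V}_{\rm s}(\mathcal{M}_0)$ is a locally stable equilibrium if there is $\eta>0$ with $\mathcal{E}(y+\tilde y,y)\ge0$ for all $\tilde y\in\mathscr{V}_{\rm c}(\mathcal{M}_0)$ with $\|\boldsymbol{d}\tilde y\|_{\mathscr{L}^2(\mathcal{M}_1)}\le\eta$. Bond-length $1$-forms: $[\boldsymbol{d}y]=\{\alpha\in\mathscr{V}_{\rm s}(\mathcal{M}_1):\|\alpha\|_\infty\le\frac12,\ \alpha(e)-\boldsymbol{d}y(e)\in\mathbb{Z}\ \forall e\in\mathcal{M}_1\}$. **Green's function.** $\mathcal{G}:\mathcal{M}_0^*\times\mathcal{M}_0^*\to\mathbb{R}$ is a function such that (1) $\mathcal{G}(\cdot,\tilde e)\in\mathscr{V}_{\rm s}(\mathcal{M}_0^* )$ for every $\tilde e$; (2) $\mathcal{G}(e,\tilde e)=\mathcal{G}(\tilde e,e)$; (3) $\boldsymbol{\delta}^*\boldsymbol{d}^*\mathcal{G}(\cdot,\tilde e)=\mathbb{1}_{\tilde e}+\mathbb{1}_{\tilde e'}$ (operators acting in the first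 variable); (4) there is $C>0$ with $|\boldsymbol{d}^*_1\mathcal{G}(e,\tilde e)|\le C\,(1+(1+|e|_{\mathcal{W}})D_{\mathcal{W}}(e,\tilde e))^{-1}$ for all $e\in\mathcal{M}_1^*$, $\tilde e\in\mathcal{M}_0^*$ on the same branch, where $\boldsymbol{d}_1^*$ acts in the first variable; (5) there is $\epsilon'>0$ independent of $\tilde e$ with $\|\boldsymbol{d}^*_1\mathcal{G}(\cdot,\tilde e)\|_\infty<\frac12-\epsilon'$. The existence of such $\mathcal{G}$ is known (proved in the same paper). *)

(* Defs.v *)
From HB Require Import structures.
From mathcomp Require Import all_boot all_order all_algebra zify.
From mathcomp Require Import boolp classical_sets functions cardinality fsbigop.
From mathcomp Require Import reals constructive_ereal ereal esum trigo.

Set Implicit Arguments.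
Unset Strict Implicit.
Unset Printing Implicit Defensive.

Import Order.TTheory GRing.Theory Num.Theory.

Local Open Scope classical_set_scope.
Local Open Scope ring_scope.

(* The lattice manifold complex.                                              *)
(*                                                                            *)
(* A 0-cell ((i, j), b) sits at position (i - 1/2, j - 1/2) of the lattice    *)
(* Z^2 - (1/2, 1/2); the branches +1, -1 are encoded as true, false.          *)
(* The crack {(x, 0) | x <= 0} thus separates the row j = 1 (above) from the  *)
(* row j = 0 (below) in the columns i <= 0.                                   *)

Definition M0 : Type := (int * int * bool)%type.

Definition refl0 (a : M0) : M0 := ((a.1.1, 1 - a.1.2), ~~ a.2).

Definition nearest (p q : int * int) : bool :=
  (`|p.1 - q.1| + `|p.2 - q.2| == 1)%N.

Definition crosses (p q : int * int) : bool :=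
  [&& p.1 == q.1, p.1 <= 0 &
      ((p.2 == 0) && (q.2 == 1)) || ((p.2 == 1) && (q.2 == 0))].

Definition adj (a c : M0) : bool :=
  nearest a.1 c.1 && (c.2 == (if crosses a.1 c.1 then ~~ a.2 else a.2)).

Lemma adjC a c : adj a c = adj c a.
Proof.
move: a c => [[i j] b] [[k l] b']; rewrite /adj /=.
have -> : crosses (i, j) (k, l) = crosses (k, l) (i, j).
  by rewrite /crosses /=; lia.
have -> : nearest (i, j) (k, l) = nearest (k, l) (i, j).
  by rewrite /nearest /=; lia.
by case: ifP => _; case: b; case: b'.
Qed.

Lemma adj_refl0 a c : adj (refl0 a) (refl0 c) = adj a c.
Proof.
move: a c => [[i j] b] [[k l] b']; rewrite /adj /refl0 /=.
have -> : crosses (i, 1 - j) (k, 1 - l) = crosses (i, j) (k, l).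
  by rewrite /crosses /=; lia.
have -> : nearest (i, 1 - j) (k, 1 - l) = nearest (i, j) (k, l).
  by rewrite /nearest /=; lia.
by case: ifP => _; case: b; case: b'.
Qed.

(* Oriented 1-cells [a, c]. *)
Definition M1 : Type := {p : M0 * M0 | adj p.1 p.2}.
HB.instance Definition _ := Countable.on M1.

Definition tail1 (e : M1) : M0 := (val e).1.
Definition head1 (e : M1) : M0 := (val e).2.

Fact opp1_subproof (e : M1) : adj (head1 e) (tail1 e).
Proof. by rewrite adjC; exact: (valP e). Qed.
Definition opp1 (e : M1) : M1 := Sub (head1 e, tail1 e) (opp1_subproof e).

Fact refl1_subproof (e : M1) : adj (refl0 (tail1 e)) (refl0 (head1 e)).
Proof. by rewrite adj_refl0; exact: (valP e). Qed.
Definition refl1 (e : M1) : M1 :=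
  Sub (refl0 (tail1 e), refl0 (head1 e)) (refl1_subproof e).

(* Unoriented 2-cells, indexed by the locations of their dual 0-cells: there  *)
(* is a single one, on branch +1, over the origin.                            *)
Definition site_ok (s : int * int * bool) : bool := (s.1 != (0, 0)) || s.2.
Definition site : Type := {s : int * int * bool | site_ok s}.
HB.instance Definition _ := Countable.on site.

Definition on_crack (l : int * int) : bool := (l.1 <= 0) && (l.2 == 0).

(* The clockwise loop bounding a 2-cell, as a cyclic sequence of vertices. *)
Definition clockwise (s : site) : seq M0 :=
  let: ((x, y), b) := val s in
  if (x, y) == (0, 0) then
    [:: ((1, 1), true);  ((1, 0), true);  ((0, 0), true);
        ((0, 1), false); ((1, 1), false); ((1, 0), false); ((0, 0), false);
        ((0, 1), true)]
  else
    let b' := if on_crack (x, y) then ~~ b else b in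
    [:: ((x, y + 1), b); ((x + 1, y + 1), b); ((x + 1, y), b'); ((x, y), b')].

(* Oriented 2-cells; (s, true) is the positively oriented (clockwise) loop. *)
Definition M2 : Type := (site * bool)%type.

Definition opp2 (F : M2) : M2 := (F.1, ~~ F.2).

Fact refl_site_subproof (s : site) :
  site_ok (if on_crack (val s).1 then val s
           else (((val s).1.1, - (val s).1.2), ~~ (val s).2)).
Proof.
case: s => [[[x y] b] /= ok]; case: ifP => // /negbT.
by rewrite /on_crack /site_ok /= xpair_eqE; lia.
Qed.
Definition refl_site (s : site) : site := Sub _ (refl_site_subproof s).

(* Crack reflection maps clockwise loops to anticlockwise ones; the loops     *)
(* around crack points are their own reflection, with orientation reversed.   *)
Definition refl2 (F : M2) : M2 := (refl_site F.1, ~~ F.2).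

Definition loop2 (F : M2) : seq M0 :=
  if F.2 then clockwise F.1 else rev (clockwise F.1).

(* The edges joining cyclically consecutive vertices of the loop; insub only  *)
(* attaches the adjacency proofs, see bdE. *)
Definition bd (F : M2) : seq M1 :=
  pmap insub (zip (loop2 F) (rot 1 (loop2 F))).

Lemma bdE (F : M2) : map val (bd F) = zip (loop2 F) (rot 1 (loop2 F)).
Proof.
have bdE_all : all (fun p : M0 * M0 => adj p.1 p.2)
                   (zip (loop2 F) (rot 1 (loop2 F))).
  case: F => [[[[x y] b] ok] o]; rewrite /loop2 /clockwise /= /on_crack /=.
  have [_|] := boolP ((x, y) == (0, 0)); first by case: o.
  rewrite xpair_eqE => xy0.
  have [xy|xy] := boolP ((x <= 0) && (y == 0)); case: o; case: b ok => ok;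
    rewrite /adj /nearest /crosses /=; do ![case: ifP => /= ?]; lia.
rewrite /bd; elim: (zip _ _) bdE_all => //= p s IHs /andP[adjp /IHs IH].
by rewrite insubT /= IH.
Qed.

Lemma loop2_refl (F : M2) :
  exists k, loop2 (refl2 F) = rot k (map refl0 (loop2 F)).
Proof.
case: F => [[[[x y] b] ok] o]; rewrite /loop2 /refl2 /clockwise /refl_site /=.
rewrite /on_crack /=.
have [/andP[x0 /eqP ->]|nc] := boolP ((x <= 0) && (y == 0)).
  have [_|nz] := boolP ((x, 0) == (0, 0)).
    by case: o; [exists 6%N | exists 2%N].
  exists 0%N; rewrite /= eqxx andbT x0 !rot0.
  by case: o; case: b {ok}; rewrite /= /refl0 /= ?subr0 ?add0r ?subrr.
exists 0%N; rewrite rot0 /=.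
have /negbTE -> : (x, y) != (0, 0) by rewrite xpair_eqE; lia.
have /negbTE -> : (x, - y) != (0, 0) by rewrite xpair_eqE; lia.
have /negbTE -> : ~~ ((x <= 0) && (- y == 0)) by lia.
have E1 : 1 - (y + 1) = - y by lia.
have E2 : 1 - y = - y + 1 by lia.
by case: o; case: b {ok}; rewrite /= /refl0 /= E1 E2.
Qed.

(* The 2-cell on the right of a directed edge. The branch of a cell around a  *)
(* crack point is that of its upper vertices.                                 *)
Definition right_site_raw (a c : M0) : int * int * bool :=
  let: ((i, j), b) := a in
  let: ((k, l), _) := c in
  let p := if k == i + 1 then (i, j - 1)      (* rightward *)
           else if k == i - 1 then (k, j)     (* leftward *)
           else if l == j + 1 then (i, j)     (* upward *)
           else (i - 1, l) in                 (* downward *)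
  (p, if p == (0, 0) then true
      else if on_crack p then (if j == 1 then b else ~~ b) else b).

Fact right_site_subproof (e : M1) : site_ok (right_site_raw (tail1 e) (head1 e)).
Proof.
case: (tail1 e) (head1 e) => [[i j] b] [[k l] b']; rewrite /right_site_raw.
by rewrite /site_ok /=; case: eqP.
Qed.
Definition right_site (e : M1) : site := Sub _ (right_site_subproof e).
Definition left_site (e : M1) : site := right_site (opp1 e).

Lemma nearestP i j k l : nearest (i, j) (k, l) ->
  [\/ k = i + 1 /\ l = j, k = i - 1 /\ l = j,
      k = i /\ l = j + 1 | k = i /\ l = j - 1].
Proof.
rewrite /nearest /=; case: (ltrgtP i k) => ik nn;
  [apply: Or41 | apply: Or42 | case: (ltrgtP j l) => jl; [apply: Or43|apply: Or44|]];
  lia.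
Qed.

(* An edge runs clockwise around the 2-cell on its right, and around no other. *)
Lemma mem_bd (s : site) (e : M1) : (e \in bd (s, true)) = (right_site e == s).
Proof.
have N1 (z : int) : (z == z + 1) = false by lia.
have N2 (z : int) : (z == z - 1) = false by lia.
have N3 (z : int) : (z - 1 == z + 1) = false by lia.
have N4 (z : int) : (z == z + 1 + 1) = false by lia.
have N5 (z : int) : (z + 1 - 1) = z by lia.
have N := (eqxx, N1, N2, N3, N4, N5, subrK).
rewrite -(mem_map val_inj) bdE -val_eqE /=.
case: e => [[[[i j] b] [[k l] b']] /=]; rewrite /tail1 /head1 /=.
case: s => [[[x y] c] ok]; rewrite /loop2 /clockwise /on_crack /=.
rewrite /site_ok xpair_eqE /= in ok; rewrite xpair_eqE => ade.
have {}ade : [/\ [\/ k = i + 1 /\ l = j, k = i - 1 /\ l = j,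
      k = i /\ l = j + 1 | k = i /\ l = j - 1] & 
      b' = (if crosses (i, j) (k, l) then ~~ b else b)].
  by move/andP: ade => [/nearestP + /eqP].
have [/andP[/eqP x0 /eqP y0]|xy] := boolP ((x == 0) && (y == 0)).
  subst x y; case: c ok => // _.
  apply/idP/idP.
    by rewrite /rot /= !inE => /or4P[||| /or4P[|||/orP[]]] /eqP[? ? ? ? ? ?]; subst.
  case: ade => + ->.
  case => [] [-> ->]; rewrite /= ?N.
  - move=> /andP[/eqP[Ei Ej] _].
    have {Ei} -> : i = 0 by clear -Ei; lia.
    have {Ej} -> : j = 1 by clear -Ej; lia.
    by case: b.
  - move=> /andP[/eqP[Ei Ej] _].
    have {Ei} -> : i = 1 by clear -Ei; lia.
    have {Ej} -> : j = 0 by clear -Ej; lia.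
    by case: b.
  - move=> /andP[/eqP[Ei Ej] _].
    have {Ei} -> : i = 0 by clear -Ei; lia.
    have {Ej} -> : j = 0 by clear -Ej; lia.
    by case: b.
  - move=> /andP[/eqP[Ei Ej] _].
    have {Ei} -> : i = 1 by clear -Ei; lia.
    have {Ej} -> : j = 1 by clear -Ej; lia.
    by case: b.
apply/idP/idP.
  rewrite /rot /= !inE => /or4P[] /eqP[? ? ? ? ? ?]; subst; rewrite ?N {ade ok}.
  1-4: rewrite ?xpair_eqE ?(negbTE xy) /=.
  1-4: have [/andP[_ /eqP ->]|xc] := boolP ((x <= 0) && (y == 0)).
  1-8: by rewrite ?N ?negbK /= ?N.
case: ade => dirs ->; case: dirs => [] [-> ->]; rewrite /= ?N => /andP[/eqP[Ex Ey] /eqP];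
  subst x y; rewrite /= xpair_eqE (negbTE xy) => Ec; subst c; clear ok;
  rewrite ?N /rot /crosses /= !inE !xpair_eqE ?N /=.
all: have [j0|j0] := eqVneq j 0; [subst j|have [j1|j1] := eqVneq j 1; [subst j|]].
all: rewrite ?(negbTE j0) ?(negbTE j1) ?subrr ?add0r /= ?andbF ?andbT /= ?eqxx //=.
all: try by case: (_ <= 0); case: b.
all: rewrite ?subr_eq0 ?(negbTE j1) ?(negbTE j0) ?andbF /= ?eqxx //=.
have -> : (i - 1 <= 0) = (i <= 0) by clear -xy; lia.
by case: (_ <= 0); case: b.
Qed.

(* The dual complex. The dual cell of e is represented by e itself, so the     *)
(* bijections star are identities: a dual 0-cell (s, o) is the point s with    *)
(* orientation o, and the dual edge e runs from left_site e to right_site e.   *)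

Definition dM0 : Type := M2.
Definition dM1 : Type := M1.
Definition star2 (F : M2) : dM0 := F.
Definition star1 (e : M1) : dM1 := e.

Definition dtail1 (e : dM1) : dM0 := (left_site e, true).
Definition dhead1 (e : dM1) : dM0 := (right_site e, true).

(* Forms are functions on oriented cells, odd under reversal of orientation.   *)
(* V_s asks for invariance under crack reflection; primal 0-cells carry no     *)
(* orientation, but dual 0-cells do.                                           *)

Section forms.
Variable R : realType.
Implicit Types (y : M0 -> R) (alpha : M1 -> R) (mu : M2 -> R).
Implicit Types (f : dM0 -> R) (beta : dM1 -> R).

Definition Vs0 y : Prop := forall a, y (refl0 a) = y a.

Definition Vc0 y : Prop := Vs0 y /\ finite_set [set a | y a != 0].

Definition Vs1 alpha : Prop :=
  (forall e, alpha (opp1 e) = - alpha e) /\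
  (forall e, alpha (refl1 e) = alpha e).

Definition dVs0 f : Prop :=
  (forall p, f (opp2 p) = - f p) /\ (forall p, f (refl2 p) = f p).

(* In \bar R, so that unbounded forms have norm +oo. *)
Definition supnorm (T : Type) (f : T -> R) : \bar R :=
  ereal_sup [set `|f e|%:E | e in [set: T]].

Definition L2norm alpha : \bar R :=
  sqrte (\esum_(e in [set: M1]) (alpha e ^+ 2)%:E).

Definition d0 y : M1 -> R := fun e => y (head1 e) - y (tail1 e).

Definition d1 alpha : M2 -> R := fun F => \sum_(e <- bd F) alpha e.

Definition delta1 alpha : M0 -> R :=
  fun a => \sum_(e \in [set e : M1 | head1 e = a]) alpha e.

Definition star_form1 alpha : dM1 -> R := fun e => alpha e.

Definition dd0 f : dM1 -> R := fun e => f (dhead1 e) - f (dtail1 e).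

(* For a negatively oriented dual 0-cell the incoming flux changes sign. *)
Definition ddelta1 beta : dM0 -> R :=
  fun p => (if p.2 then 1 else -1) *
           \sum_(e \in [set e : dM1 | dhead1 e = (p.1, true)]) beta e.

Definition ind2 (F : M2) : M2 -> R :=
  fun E => (E == F)%:R - (E == opp2 F)%:R.

(* Positions in the plane, and distances. *)

Definition enorm (z : R * R) : R := Num.sqrt (z.1 ^+ 2 + z.2 ^+ 2).

(* The argument in (-pi, pi], see argP; its value at 0 is irrelevant. *)
Definition arg (z : R * R) : R :=
  if 0 <= z.2 then acos (z.1 / enorm z) else - acos (z.1 / enorm z).

Lemma argP (z : R * R) : z != (0, 0) ->
  [/\ - pi < arg z <= pi, z.1 = enorm z * cos (arg z)
    & z.2 = enorm z * sin (arg z)].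
Proof.
case: z => x y; rewrite xpair_eqE /arg /=; set r := enorm _ => xy0.
have r2 : r ^+ 2 = x ^+ 2 + y ^+ 2 by rewrite sqr_sqrtr // addr_ge0 ?sqr_ge0.
have r_ge0 : 0 <= r by exact: sqrtr_ge0.
have r_gt0 : 0 < r.
  rewrite lt_def r_ge0 andbT -sqrf_eq0 r2 paddr_eq0 ?sqr_ge0 //.
  by rewrite !sqrf_eq0.
have x1 : -1 <= x / r <= 1.
  rewrite -ler_norml normrM normfV (gtr0_norm r_gt0) ler_pdivrMr // mul1r.
  by rewrite -(ger0_norm r_ge0) -ler_sqr ?nnegrE // !real_normK ?num_real //
     r2 lerDl sqr_ge0.
have xE : r * (x / r) = x by rewrite mulrC divfK ?gt_eqF.
have [a_ge0 a_le] := (acos_ge0 x1, acos_lepi x1).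
have ca : cos (acos (x / r)) = x / r by rewrite acosK // in_itv.
have rs : r * sin (acos (x / r)) = `|y|.
  rewrite sin_acos // -{1}(ger0_norm r_ge0) -sqrtr_sqr -sqrtrM ?sqr_ge0 //.
  by rewrite mulrBr mulr1 -exprMn xE r2 addrC addKr sqrtr_sqr.
have [y0|y0] := leP 0 y; rewrite ?cosN ?sinN ca xE.
  split=> //; last by rewrite rs ger0_norm.
  by rewrite a_le andbT (lt_le_trans _ a_ge0) // oppr_lt0 pi_gt0.
split=> //; last by rewrite mulrN rs ltr0_norm // opprK.
rewrite ltrN2 (le_trans _ (pi_ge0 R)) ?oppr_le0 // andbT.
rewrite lt_neqAle a_le andbT; apply/eqP => api; move: rs.
rewrite api sinpi mulr0 => /esym/eqP; rewrite normr_eq0 => /eqP y00.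
by rewrite y00 ltxx in y0.
Qed.

Definition omega (z : R * R) : R * R :=
  (Num.sqrt (enorm z) * cos (arg z / 2), Num.sqrt (enorm z) * sin (arg z / 2)).

Definition site_pos (s : site) : R * R :=
  ((val s).1.1%:~R, (val s).1.2%:~R).

Definition chi2 (F : M2) : set (R * R) :=
  [set z | `|z.1 - (site_pos F.1).1| < 2^-1 /\ `|z.2 - (site_pos F.1).2| < 2^-1].

Definition dchi0 (p : dM0) : set (R * R) := [set site_pos p.1].

Definition dchi1 (e : dM1) : set (R * R) :=
  let p := site_pos (dtail1 e).1 in let q := site_pos (dhead1 e).1 in
  [set (p.1 + t * (q.1 - p.1), p.2 + t * (q.2 - p.2)) | t in [set t | 0 < t < 1]].

Definition dist (A B : set (R * R)) : R :=
  inf [set enorm (x.1 - x'.1, x.2 - x'.2) | x in A & x' in B].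

Definition distW (A B : set (R * R)) : R := dist (omega @` A) (omega @` B).

Definition normW (A : set (R * R)) : R := inf [set enorm (omega x) | x in A].

(* Admissible configurations. *)

Definition M2plus (F : M2) : bool := all (fun a : M0 => a.2) (loop2 F).

Definition dislocations (m : nat) (b : 'I_m -> R) (e : 'I_m -> M2) : M2 -> R :=
  fun F => \sum_(i < m) b i * (ind2 (e i) F + ind2 (refl2 (e i)) F).

Definition separated (eps : R) (n m : nat) (e : 'I_m -> M2) : Prop :=
  forall i j, i != j ->
    eps * n%:R <= Num.max (dist (chi2 (e i)) (chi2 (e j)))
                          (distW (chi2 (e i)) (chi2 (e j))).

(* mu is in B_n, as witnessed by the cells e: B_n is the set of all mu such    *)
(* that calB eps b n mu e for some e. M2plus and (e i).2 say that e i lies on  *)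
(* branch +1 and is positively oriented.                                       *)
Definition calB (eps : R) (m : nat) (b : 'I_m -> R) (n : nat)
    (mu : M2 -> R) (e : 'I_m -> M2) : Prop :=
  [/\ mu = dislocations b e,
      forall i, M2plus (e i) /\ (e i).2
    & separated eps n e].

(* Energy and equilibria. *)

Definition distZ (x : R) : R := inf [set `|x - z%:~R| | z in [set: int]].

Definition psi (lambda x : R) : R := lambda / 2 * distZ x ^+ 2.

(* \sum_(e \in _) is the sum over the support, assumed finite: this is the     *)
(* case whenever y - y' has finite support.                                    *)
Definition energy (lambda : R) y y' : R :=
  \sum_(e \in [set: M1]) (psi lambda (d0 y e) - psi lambda (d0 y' e)).

Definition locally_stable (lambda : R) y : Prop :=
  Vs0 y /\ exists2 eta : R, 0 < eta &
    forall y', Vc0 y' -> (L2norm (d0 y') <= eta%:E)%E ->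
      0 <= energy lambda (fun a => y a + y' a) y.

Definition bond_lengths y (alpha : M1 -> R) : Prop :=
  [/\ Vs1 alpha, (supnorm alpha <= (2^-1)%:E)%E
    & forall e, alpha e - d0 y e \is a Num.int].

(* The Green's function. *)

(* Dual cells all of whose vertices are on branch c. *)
Definition dbranch0 (c : bool) (p : dM0) : Prop := (val p.1).2 = c.
Definition dbranch1 (c : bool) (e : dM1) : Prop :=
  dbranch0 c (dtail1 e) /\ dbranch0 c (dhead1 e).

Definition decay (G : dM0 -> dM0 -> R) : Prop :=
  exists2 C : R, 0 < C & forall (c : bool) (e : dM1) (p : dM0),
    dbranch1 c e -> dbranch0 c p ->
    `|dd0 (G^~ p) e| <=
      C * (1 + (1 + normW (dchi1 e)) * distW (dchi1 e) (dchi0 p))^-1.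

Definition is_green (G : dM0 -> dM0 -> R) : Prop :=
  [/\ forall p, dVs0 (G^~ p),
      forall p q, G p q = G q p,
      forall p, ddelta1 (dd0 (G^~ p)) = (fun q => ind2 p q + ind2 (refl2 p) q),
      decay G
    & exists2 eps' : R, 0 < eps' &
        forall p, (supnorm (dd0 (G^~ p)) < (2^-1 - eps')%:E)%E].

Definition green_of (G : dM0 -> dM0 -> R) (m : nat) (b : 'I_m -> R)
    (e : 'I_m -> M2) : dM0 -> R :=
  fun p => \sum_(i < m) b i * G p (star2 (e i)).

End forms.

(* Main.v *)
Require Import Defs.
From mathcomp Require Import all_boot all_order all_algebra zify ring lra.
From mathcomp Require Import boolp classical_sets functions cardinality fsbigop.
From mathcomp Require Import reals constructive_ereal ereal esum trigo.

(** The bond-length form is forced: alpha is the differential of the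
    superposition of Green's functions, read on primal edges. Duality turns
    the required equations into facts about that superposition. The circulation
    of alpha around a 2-cell is the dual co-differential at its dual point
    (d1_ddelta1), so the equation of the Green's function gives d alpha = mu;
    and the four edges into a vertex are dual to the sides of a dual face,
    around which differences sum to zero, so delta alpha = 0 (delta1_dd0).

    As mu takes integer values, alpha has a primitive y modulo integers
    (potential_mod_int). Reflection reduces this to the plane slit along the
    crack, where the primitive is an explicit path sum.

    Smallness of alpha is where separation enters (green_of_bound). One Green's
    function alone has differential below 1/2 - eps'. The decay estimate makes
    the contribution of a dislocation negligible at a dual edge e unless
    (1 + |e|_W) D_W is bounded. Since omega inverts squaring, that bound confines
    the dislocation to a Euclidean ball and to a W-ball of fixed radius around e
    (omega_close_point), so for large n separation leaves room for at most
    one of them. Thus alpha stays a fixed distance below 1/2.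

    Finally, psi is exactly quadratic near all the bond lengths, so small
    perturbations change the energy by a linear term, which vanishes by
    summation by parts because alpha is co-closed, plus a nonnegative
    quadratic term (locally_stable_coclosed). *)

Set Implicit Arguments.
Unset Strict Implicit.
Unset Printing Implicit Defensive.

Import Order.TTheory GRing.Theory Num.Theory.

Local Open Scope classical_set_scope.
Local Open Scope ring_scope.

(** * Reflection and the 2-cells beside an edge *)

Lemma refl0K : involutive refl0.
Proof. by case=> [[i j] b]; rewrite /refl0 /= negbK opprB addrC subrK. Qed.

Lemma opp1K : involutive opp1.
Proof. by move=> e; apply: val_inj; case: e => [[a c] ac]. Qed.

(** The same four directions as in right_site_raw, with the branch left
    out. *)
Definition right_pos (p q : int * int) : int * int :=
  if q.1 == p.1 + 1 then (p.1, p.2 - 1)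
  else if q.1 == p.1 - 1 then (q.1, p.2)
  else if q.2 == p.2 + 1 then p
  else (p.1 - 1, q.2).

(** Which 2-cell lies over p is determined by any vertex of that cell: by its
    branch off the crack, and by its branch and its side of the crack on it.
    Hence the 2-cell on the right of an edge can be read off at either end of
    the edge (right_site_raw_head), which is what makes the two faces meeting
    at a vertex between consecutive edges agree. *)
Definition corner (a : M0) (p : int * int) : int * int * bool :=
  (p, if p == (0, 0) then true
      else if on_crack p then (if a.1.2 == 1 then a.2 else ~~ a.2) else a.2).

Lemma right_site_raw_tail a c : right_site_raw a c = corner a (right_pos a.1 c.1).
Proof. by case: a c => [[i j] b] [[k l] b']. Qed.

Lemma right_posE i j :
  [/\ right_pos (i, j) (i + 1, j) = (i, j - 1),
      right_pos (i, j) (i - 1, j) = (i - 1, j),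
      right_pos (i, j) (i, j + 1) = (i, j)
    & right_pos (i, j) (i, j - 1) = (i - 1, j - 1)].
Proof. by split; rewrite /right_pos /=; do ![case: ifP => ?]; congr (_, _); lia. Qed.

Lemma right_site_raw_head a c :
  adj a c -> right_site_raw a c = corner c (right_pos a.1 c.1).
Proof.
rewrite right_site_raw_tail /corner.
case: a c => [[i j] b] [[k l] b'] /andP[/nearestP nac /= /eqP ->].
rewrite /crosses; congr (_, _).
case: (boolP (_ == (0, 0))) => // nz; case: (right_posE i j) => r1 r2 r3 r4.
move: nz; case: nac => [[-> ->]|[-> ->]|[-> ->]|[-> ->]];
  rewrite ?(r1, r2, r3, r4) /on_crack xpair_eqE /=;
  do ![case: ifP => /= ?]; try lia; case: b; lia.
Qed.

Definition refl_pos (p : int * int) : int * int := (p.1, - p.2).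

Lemma right_pos_refl a c : adj a c ->
  right_pos (refl0 a).1 (refl0 c).1 = refl_pos (right_pos c.1 a.1).
Proof.
case: a c => [[i j] b] [[k l] b'] /andP[/nearestP nac _].
rewrite /right_pos /refl_pos /=.
case: nac => [[-> ->]|[-> ->]|[-> ->]|[-> ->]];
  do ![case: ifP => /= ?]; congr (_, _); lia.
Qed.

Lemma corner_refl (a : M0) p : (on_crack p -> a.1.2 = 0 \/ a.1.2 = 1) ->
  corner (refl0 a) (refl_pos p) =
  if on_crack (corner a p).1 then corner a p
  else (((corner a p).1.1, - (corner a p).1.2), ~~ (corner a p).2).
Proof.
case: a p => [[i j] b] [x y]; rewrite /corner /on_crack /refl_pos /=.
rewrite !xpair_eqE oppr_eq0.
case: (boolP ((x <= 0) && (y == 0))) => [/andP[x0 /eqP ->] ij|nc _].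
  rewrite eqxx !andbT oppr0 ?x0; congr (_, _); case: ifP => // _.
  by case: (ij isT) => ->; rewrite /= ?negbK.
by case: ifP => //; lia.
Qed.

Lemma right_pos_crack a c : adj a c -> on_crack (right_pos a.1 c.1) ->
  a.1.2 = 0 \/ a.1.2 = 1.
Proof.
case: a c => [[i j] b] [[k l] b'] /andP[/nearestP nac _].
rewrite /right_pos /on_crack /=.
case: nac => [[-> ->]|[-> ->]|[-> ->]|[-> ->]]; do ![case: ifP => /= ?]; lia.
Qed.

(** Crack reflection is a reflection of the plane, so it exchanges left and
    right. *)
Lemma right_site_refl e : right_site (refl1 e) = refl_site (left_site e).
Proof.
case: e => [[a c] /= ac]; apply: val_inj.
have ca : adj c a by rewrite adjC.
change (right_site_raw (refl0 a) (refl0 c) =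
  let s := right_site_raw c a in
  if on_crack s.1 then s else ((s.1.1, - s.1.2), ~~ s.2)).
rewrite right_site_raw_tail right_pos_refl // right_site_raw_head // corner_refl //.
move=> oc; have := right_pos_crack ca oc; move: ca oc.
case: a c {ac} => [[i j] b] [[k l] b'] /andP[/nearestP nac _] /=.
case: (right_posE k l) => r1 r2 r3 r4.
by case: nac => [[-> ->]|[-> ->]|[-> ->]|[-> ->]];
  rewrite ?(r1, r2, r3, r4) /on_crack /=; lia.
Qed.

Lemma left_site_refl e : left_site (refl1 e) = refl_site (right_site e).
Proof.
have -> : right_site e = left_site (opp1 e) by rewrite /left_site opp1K.
by rewrite -right_site_refl; congr right_site; exact: val_inj.
Qed.

(** Off the crack a 2-cell has all its vertices on one branch, and both cells
    beside an edge contain its tail. *)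
Lemma off_crack_branch e :
  ~~ on_crack (val (right_site e)).1 -> ~~ on_crack (val (left_site e)).1 ->
  (val (right_site e)).2 = (val (left_site e)).2.
Proof.
case: e => [[a c] /= ac]; rewrite /= /tail1 /head1 /=.
have ca : adj c a by rewrite adjC.
rewrite right_site_raw_tail (right_site_raw_head ca) /= => /negbTE R /negbTE L.
by rewrite R L; case: eqP R => [->|_ _] //; case: eqP L => // ->.
Qed.

(** * Edges into a vertex, and simplicity of loops *)

Definition nbr (a : M0) (v : int * int) : M0 :=
  let q := (a.1.1 + v.1, a.1.2 + v.2) in
  (q, if crosses a.1 q then ~~ a.2 else a.2).

(** The filter insub drops nothing: it supplies the adjacency proofs, as
    in_edgesE records. *)
Definition in_edges (a : M0) : seq M1 :=
  pmap insub [seq (nbr a v, a) | v <- [:: (1, 0); (0, 1); (-1, 0); (0, -1)]].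

Lemma in_edgesE a : map val (in_edges a) =
  [seq (nbr a v, a) | v <- [:: (1, 0); (0, 1); (-1, 0); (0, -1)]].
Proof.
have : all (fun p : M0 * M0 => adj p.1 p.2)
   [seq (nbr a v, a) | v <- [:: (1, 0); (0, 1); (-1, 0); (0, -1)]].
  apply/allP => _ /mapP[v vI ->] /=; rewrite adjC /adj /= eqxx andbT.
  rewrite /nearest /=; move: vI; rewrite !inE.
  by move=> /or4P[] /eqP -> /=; lia.
rewrite /in_edges; elim: (map _ _) => //= p s IHs /andP[adjp /IHs IH].
by rewrite insubT /= IH.
Qed.

Lemma mem_in_edges a e : (e \in in_edges a) = (head1 e == a).
Proof.
rewrite -(mem_map val_inj) in_edgesE; apply/idP/eqP.
  by move=> /mapP[v _ E]; rewrite /head1 E.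
move=> E; apply/mapP.
case: e E => [[[[k l] b'] [[i j] b]] ac] <-; rewrite /head1 /=.
have: adj (i, j, b) (k, l, b') by rewrite adjC.
case/andP => /nearestP /= nac /eqP /= E.
exists (k - i, l - j).
  rewrite !inE; case: nac => [[-> ->]|[-> ->]|[-> ->]|[-> ->]];
    by rewrite !xpair_eqE; lia.
by rewrite /nbr /= !subrKC E.
Qed.

Lemma in_edges_uniq a : uniq (in_edges a).
Proof.
rewrite -(map_inj_uniq val_inj) in_edgesE map_inj_in_uniq // => v w _ _ /=.
by case: a v w => [[i j] b] [v1 v2] [w1 w2]; rewrite /nbr /= => -[/addrI -> /addrI ->].
Qed.

Lemma clockwise_uniq s : uniq (clockwise s).
Proof.
case: s => [[[x y] b] ok]; rewrite /clockwise /=; case: ifP => // _.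
rewrite /= !inE !xpair_eqE; lia.
Qed.

Lemma bd_uniq F : uniq (bd F).
Proof.
rewrite -(map_inj_uniq val_inj) bdE.
have := clockwise_uniq F.1.
have -> : uniq (clockwise F.1) = uniq (loop2 F).
  by rewrite /loop2; case: ifP => // _; rewrite rev_uniq.
move: (loop2 F) (rot 1 (loop2 F)) (size_rot 1 (loop2 F)) => l l' E u.
apply: (@map_uniq _ _ (fun p => p.1)).
by rewrite -/(unzip1 _) unzip1_zip ?E.
Qed.

(** * Exact dual forms are odd, reflection-invariant and co-closed *)

Lemma zip_rot1 (S T : Type) (s : seq S) (t : seq T) :
  size s = size t -> zip (rot 1 s) (rot 1 t) = rot 1 (zip s t).
Proof. by case: s t => [|x s] [|y t] //= [E]; rewrite !rot1_cons zip_rcons. Qed.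

(** Reversing a loop reverses each of its edges, up to a rotation of the list
    of edges. *)
Lemma sum_loop_rev (V : zmodType) (T : eqType) (h : T * T -> V) (l : seq T) :
  (forall x y, h (x, y) = - h (y, x)) ->
  \sum_(p <- zip (rev l) (rot 1 (rev l))) h p =
  - \sum_(p <- zip l (rot 1 l)) h p.
Proof.
move=> h_odd; rewrite -rev_rotr -rev_zip ?size_rotr //.
rewrite [LHS](perm_big (zip l (rotr 1 l))) /=; last by rewrite perm_rev.
rewrite [LHS](perm_big (rot 1 (zip l (rotr 1 l)))) /=; last first.
  by rewrite perm_sym perm_rot.
rewrite -zip_rot1 ?size_rotr // rotrK.
move: (rot 1 l) => s; elim: s l => [|x s IHs] [|y t] /=; rewrite ?big_nil ?oppr0 //.
by rewrite !big_cons IHs h_odd opprD.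
Qed.

Section Forms.
Variable R : realType.
Implicit Types (f : dM0 -> R) (beta : M1 -> R).

Lemma dd0_opp f e : dd0 f (opp1 e) = - dd0 f e.
Proof. by rewrite /dd0 /dhead1 /dtail1 /left_site opp1K opprB. Qed.

(** Reflection exchanges left and right, and negates f on dual points; the two
    signs cancel. *)
Lemma dd0_refl f e : dVs0 f -> dd0 f (refl1 e) = dd0 f e.
Proof.
move=> [f_odd f_refl]; rewrite /dd0 /dhead1 /dtail1 right_site_refl left_site_refl.
have fE s : f (refl_site s, true) = - f (s, true).
  by rewrite -(f_refl (s, true)) -f_odd.
by rewrite !fE opprK addrC.
Qed.

(** The dual point is its own reflection with the opposite orientation. *)
Lemma crack_eq0 f s : dVs0 f -> on_crack (val s).1 -> f (s, true) = 0.
Proof.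
move=> [f_odd f_refl] sc.
have sE : refl_site s = s by apply: val_inj; rewrite /= sc.
have := f_refl (s, true); rewrite /refl2 /= sE.
by rewrite -[(s, false)]/(opp2 (s, true)) f_odd; lra.
Qed.

Lemma delta1E beta a : delta1 beta a = \sum_(e <- in_edges a) beta e.
Proof.
rewrite /delta1 [RHS]fsbig_seq ?in_edges_uniq //; apply: eq_fsbigl.
by apply/seteqP; split => e /=; rewrite mem_in_edges => /eqP.
Qed.

(** On the dual side, the four edges into a vertex are the sides of the dual
    face around it, so the differences of f telescope. *)
Lemma delta1_dd0 f : delta1 (dd0 f) = fun=> 0.
Proof.
apply: funext => a; rewrite delta1E.
pose g (t : int * int * bool) := if insub t is Some s then f (s, true) else 0.
have gE e : f (right_site e, true) = g (right_site_raw (tail1 e) (head1 e)).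
  rewrite /g; case: insubP => [s _ sE|]; last by rewrite (right_site_subproof e).
  by congr (f (_, _)); exact/val_inj.
pose h (p : M0 * M0) := g (right_site_raw p.1 p.2) - g (right_site_raw p.2 p.1).
have -> : \sum_(e <- in_edges a) dd0 f e = \sum_(p <- map val (in_edges a)) h p.
  by rewrite big_map; apply: eq_bigr => e _; rewrite /dd0 /dhead1 /dtail1 !gE.
have hE c d : h (c, d) =
  g (right_site_raw c d) - g (right_site_raw d c) by [].
rewrite in_edgesE big_map !big_cons big_nil !hE {h hE}.
have adjn v : v \in [:: (1, 0); (0, 1); (-1, 0); (0, -1)] -> adj (nbr a v) a.
  move=> vI; have : (nbr a v, a) \in map val (in_edges a).
    by rewrite in_edgesE; exact/map_f.
  by case/mapP => e _ E; have := valP e; rewrite -E.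
rewrite !(right_site_raw_tail a) !right_site_raw_head ?adjn //.
case: a {adjn} => [[i j] b]; rewrite /nbr /= !addr0.
case: (right_posE i j) => -> -> -> ->.
have [_ + _ _] := right_posE (i + 1) j; rewrite addrK => ->.
have [+ _ _ _] := right_posE (i - 1) j; rewrite subrK => ->.
have [_ _ _ +] := right_posE i (j + 1); rewrite addrK => ->.
have [_ _ + _] := right_posE i (j - 1); rewrite subrK => ->.
by ring.
Qed.

Lemma ddelta1E beta F : ddelta1 beta F =
  (if F.2 then 1 else -1) * \sum_(e <- bd (F.1, true)) beta e.
Proof.
rewrite /ddelta1 [in RHS]fsbig_seq ?bd_uniq //; congr (_ * _); apply: eq_fsbigl.
apply/seteqP; split => e /=; rewrite mem_bd /dhead1; first by case=> ->.
by move/eqP => ->.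
Qed.

(** Extension of a 1-form by zero to all pairs of vertices, so that sums along
    explicit lists of vertices need no adjacency proofs. *)
Definition pair_form beta (p : M0 * M0) : R :=
  if insub p is Some e then beta e else 0.

Lemma pair_formE beta e : pair_form beta (val e) = beta e.
Proof.
rewrite /pair_form; case: insubP => [e' _ eE|]; last by rewrite (valP e).
by congr (beta _); exact/val_inj.
Qed.

Lemma pair_form_odd beta a c : (forall e, beta (opp1 e) = - beta e) ->
  pair_form beta (a, c) = - pair_form beta (c, a).
Proof.
move=> beta_odd; case: (boolP (adj c a)) => ca; last first.
  by rewrite /pair_form !insubN /= ?oppr0 // adjC.
pose e : M1 := Sub (c, a) ca.
by rewrite -[(a, c)]/(val (opp1 e)) -[(c, a)]/(val e) !pair_formE beta_odd.
Qed.

Lemma d1_pair_form beta F : d1 beta F =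
  \sum_(p <- zip (loop2 F) (rot 1 (loop2 F))) pair_form beta p.
Proof. by rewrite -bdE big_map; apply: eq_bigr => e _; rewrite pair_formE. Qed.

(** The edges of the clockwise loop around a dual point are exactly those
    whose dual edge ends there (mem_bd). Both sides change sign with the
    orientation. *)
Lemma d1_ddelta1 beta F : (forall e, beta (opp1 e) = - beta e) ->
  d1 beta F = ddelta1 beta F.
Proof.
move=> beta_odd; rewrite ddelta1E.
case: F => s [] /=; first by rewrite mul1r.
rewrite mulN1r -/(d1 beta (s, true)) !d1_pair_form /loop2 /=.
by rewrite sum_loop_rev // => x y; exact: pair_form_odd.
Qed.
End Forms.

(** * Primitives modulo integers *)

Section Potential.
Variable R : realType.
Implicit Types (beta : M1 -> R).

Definition int_primitive (f : int -> R) (i : int) : R :=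
  match i with
  | Posz n => \sum_(k < n) f k%:Z
  | Negz n => - \sum_(k < n.+1) f (- k.+1%:Z)
  end.

Lemma int_primitiveD1 f i : int_primitive f (i + 1) - int_primitive f i = f i.
Proof.
case: i => [n|[|n]].
- by rewrite -PoszD addn1 /= big_ord_recr /= addrAC subrr add0r.
- rewrite (_ : Negz 0 + 1 = 0%N) //= big_ord0 big_ord1 sub0r opprK.
  by congr f; lia.
- rewrite (_ : Negz n.+1 + 1 = Negz n); last by lia.
  rewrite /= [X in _ - - X]big_ord_recr /= opprK addKr.
  by congr f; lia.
Qed.

Lemma int_ind1 (P : int -> Prop) : P 1 ->
  (forall i : int, 1 <= i -> P i -> P (i + 1)) ->
  (forall i : int, i <= 0 -> P (i + 1) -> P i) -> forall i, P i.
Proof.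
move=> P1 Pup Pdown i; case: (lerP 1 i) => i1.
  suff H (n : nat) : P (1 + n%:Z) by apply: (eq_ind _ P (H `|i - 1|%N)); lia.
  elim: n => [|n IHn]; first by rewrite addr0.
  by apply: (eq_ind _ P (Pup _ _ IHn)); lia.
suff H (n : nat) : P (1 - n%:Z) by apply: (eq_ind _ P (H `|1 - i|%N)); lia.
elim: n => [|n IHn]; first by rewrite subr0.
by apply: Pdown; [lia | apply: (eq_ind _ P IHn); lia].
Qed.

(** By reflection it is enough to integrate over branch +1, where the crack is
    a slit: every unit square not centred on the crack is a face. There z
    integrates beta up column 1, which the slit does not meet, and then along
    the rows. So beta - dz vanishes on horizontal edges; on vertical ones it
    vanishes in column 1 and changes by the circulation around a face from one
    column to the next, hence is an integer. Extending z by reflection makes y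
    constant along edges across the crack; these join a vertex to its
    reflection, so reflection reverses them, and beta vanishes there. *)
Lemma potential_mod_int beta : Vs1 beta -> (forall F, d1 beta F \is a Num.int) ->
  exists2 y, Vs0 y & forall e, beta e - d0 y e \is a Num.int.
Proof.
move=> [beta_odd beta_refl] beta_int.
pose B := pair_form beta.
pose h (i j : int) := B ((i, j, true), (i + 1, j, true)).
pose v (i j : int) := B ((i, j, true), (i, j + 1, true)).
pose z (i j : int) :=
  int_primitive (v 1) j + int_primitive (h^~ j) i - int_primitive (h^~ j) 1.
have B_odd a c : B (a, c) = - B (c, a) by exact: pair_form_odd.
have hz (i j : int) : z (i + 1) j - z i j = h i j.
  by have /= <- := int_primitiveD1 (h^~ j) i; rewrite /z; ring.
have face (i j : int) : ~~ on_crack (i, j) ->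
    h i (j + 1) - v (i + 1) j - h i j + v i j \is a Num.int.
  move=> ij; have ij0 : (i, j) != (0, 0) by apply: contraNneq ij => ->.
  have ok : site_ok (i, j, true) by rewrite /site_ok ij0.
  have := beta_int (Sub (i, j, true) ok, true).
  rewrite d1_pair_form /loop2 /clockwise /= (negbTE ij0) (negbTE ij).
  rewrite /rot /= !big_cons big_nil -/B -/(h i (j + 1)) -/(v i j).
  rewrite [B ((i + 1, j + 1, true), _)]B_odd -/(v (i + 1) j).
  rewrite [B ((i + 1, j, true), _)]B_odd -/(h i j).
  by congr (_ \is a Num.int); ring.
have vz (i j : int) : ~~ ((i <= 0) && (j == 0)) ->
    v i j - (z i (j + 1) - z i j) \is a Num.int.
  have step k : (v (k + 1) j - (z (k + 1) (j + 1) - z (k + 1) j)) -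
      (v k j - (z k (j + 1) - z k j)) = - (h k (j + 1) - v (k + 1) j - h k j + v k j).
    by rewrite -(hz k (j + 1)) -(hz k j); ring.
  elim/int_ind1: i => [_|i i1 IHi _|i i0 IHi ij].
  - have E : z 1 (j + 1) - z 1 j = v 1 j.
      by have <- := int_primitiveD1 (v 1) j; rewrite /z; ring.
    by rewrite E subrr.
  - rewrite -[X in X \is a _](subrK (v i j - (z i (j + 1) - z i j))) step.
    rewrite rpredD ?rpredN ?face //; first by rewrite /on_crack /=; lia.
    by apply: IHi; lia.
  - rewrite -[X in X \is a _](subKr (v (i + 1) j - (z (i + 1) (j + 1) - z (i + 1) j))).
    rewrite step opprK rpredD ?face //; apply: IHi; lia.
pose y (a : M0) := if a.2 then z a.1.1 a.1.2 else z a.1.1 (1 - a.1.2).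
have yE a : y (refl0 a) = y a.
  have E j : 1 - (1 - j) = j :> int by lia.
  by rewrite /y /=; case: a => [[i j] b] /=; case: b => /=; rewrite ?E.
exists y => // e.
have B_e : beta e = B (val e) by rewrite /B pair_formE.
have d0_refl e' : d0 y (refl1 e') = d0 y e' by rewrite /d0 /head1 /tail1 /= !yE.
have [cr|ncr] := eqVneq (head1 e) (refl0 (tail1 e)).
  have re : refl1 e = opp1 e by apply: val_inj; rewrite /= cr refl0K.
  have -> : beta e = 0 by have := beta_refl e; rewrite re beta_odd; lra.
  by rewrite /d0 cr yE subrr subr0 rpred0.
(* An edge that does not cross the crack, or its reflection, lies on
   branch +1. *)
wlog tb : e B_e ncr / (tail1 e).2 = true.
  move=> wl; case E : (tail1 e).2; first exact: wl.
  rewrite -beta_refl -d0_refl; apply: wl.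
  - by rewrite /B pair_formE.
  - apply: contra_neq ncr => E'; rewrite -[LHS]refl0K -[tail1 e]refl0K.
    by congr refl0; exact: E'.
  - by rewrite /= E.
rewrite B_e /d0 {beta_refl B_e d0_refl}.
case: e ncr tb => [[[[i j] b] [[k l] b']] /= ae]; rewrite /head1 /tail1 /= => + bT.
subst b; move: ae; rewrite /adj /= => /andP[/nearestP + /eqP ->].
rewrite /refl0 /y /=; case: ifP => [|nc nkl _].
  rewrite /crosses /= => /and3P[/eqP <- _ kl] _ /eqP[].
  by congr (_, _, _); lia.
case: nkl => [] [? ?]; subst k l.
- by rewrite -/(h i j) hz subrr rpred0.
- have := hz (i - 1) j; rewrite /h subrK [RHS]B_odd => E.
  rewrite (_ : B _ = z (i - 1) j - z i j) ?subrr ?rpred0 //; lra.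
- by apply: vz; move: nc; rewrite /crosses /=; lia.
- have : v i (j - 1) - (z i j - z i (j - 1)) \is a Num.int.
    have /= := @vz i (j - 1); rewrite subrK; apply.
    by move: nc; rewrite /crosses /=; lia.
  rewrite {1}/v subrK -rpredN; congr (_ \is a Num.int).
  by rewrite [in RHS]B_odd; ring.
Qed.
End Potential.

(** * The square root map on the slit plane *)

Section Geometry.
Variable R : realType.
Implicit Types (z w : R * R).

Lemma sqr_enorm z : enorm z ^+ 2 = z.1 ^+ 2 + z.2 ^+ 2.
Proof. by rewrite sqr_sqrtr // addr_ge0 ?sqr_ge0. Qed.

Lemma enorm_ge0 z : 0 <= enorm z.
Proof. exact: sqrtr_ge0. Qed.

Lemma norm_le_enorm z : `|z.1| <= enorm z /\ `|z.2| <= enorm z.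
Proof.
by split; rewrite -sqrtr_sqr ler_sqrt ?addr_ge0 ?sqr_ge0 // ?lerDl ?lerDr sqr_ge0.
Qed.

Lemma enorm_le z : enorm z <= `|z.1| + `|z.2|.
Proof.
rewrite -ler_sqr ?nnegrE ?enorm_ge0 ?addr_ge0 // sqr_enorm sqrrD !real_normK ?num_real //.
by rewrite -addrA lerD2l lerDr mulrn_wge0 // mulr_ge0.
Qed.

Lemma enorm_conj z : enorm (z.1, - z.2) = enorm z.
Proof. by rewrite /enorm sqrrN. Qed.

(** As a complex number, omega z is the square root of z with nonnegative real
    part; its imaginary part has the sign of that of z. Everything used about
    omega below follows from these four facts. *)
Lemma omegaP z : let w := omega z in
  [/\ w.1 ^+ 2 - w.2 ^+ 2 = z.1, 2 * w.1 * w.2 = z.2, 0 <= w.1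
    & if 0 <= z.2 then 0 <= w.2 else w.2 <= 0].
Proof.
rewrite /omega /=; set r := Num.sqrt (enorm z).
have r2 : r ^+ 2 = enorm z by rewrite sqr_sqrtr // enorm_ge0.
have r0 : 0 <= r by exact: sqrtr_ge0.
have x1 : -1 <= z.1 / enorm z <= 1.
  rewrite -ler_norml normrM normfV (ger0_norm (enorm_ge0 z)).
  have [->|nz] := eqVneq (enorm z) 0; first by rewrite invr0 mulr0.
  rewrite ler_pdivrMr ?mul1r ?(norm_le_enorm z).1 //.
  by rewrite lt_def nz enorm_ge0.
have [a0 api] := (acos_ge0 x1, acos_lepi x1).
have p0 := pi_gt0 R.
have [zE1 zE2] : z.1 = enorm z * cos (arg z) /\ z.2 = enorm z * sin (arg z).
  have [->|z0] := eqVneq z (0, 0); last by case: (argP z0).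
  by rewrite /enorm /= expr0n addr0 sqrtr0 !mul0r.
have argE : arg z = (arg z / 2) *+ 2 by rewrite -mulr_natr divfK ?pnatr_eq0.
rewrite argE cos_mulr2n in zE1; rewrite argE sin_mulr2n in zE2.
split.
- rewrite [RHS]zE1 -r2; have := cos2Dsin2 (arg z / 2); nra.
- by rewrite [RHS]zE2 -r2; ring.
- rewrite mulr_ge0 // cos_ge0_pihalf // /arg; case: ifP => _; apply/andP; split; lra.
- rewrite /arg; case: (leP 0 z.2) => _.
    by rewrite mulr_ge0 // sin_ge0_pi //; apply/andP; split; lra.
  by rewrite mulNr sinN mulrN oppr_le0 mulr_ge0 // sin_ge0_pi //; apply/andP; split; lra.
Qed.

(** The equation fails on the cut: a point there is its own conjugate, but
    omega sends it to the positive imaginary axis. *)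
Lemma omega_conj z : (z.2 != 0) || (0 < z.1) ->
  omega (z.1, - z.2) = ((omega z).1, - (omega z).2).
Proof.
move=> zP; rewrite /omega enorm_conj.
suff -> : arg (z.1, - z.2) = - arg z by rewrite mulNr cosN sinN mulrN.
rewrite /arg /= enorm_conj oppr_ge0.
case: (ltrgtP z.2 0) zP => [z2|z2|z2 /= z1]; rewrite ?opprK //.
have -> : z.1 / enorm z = 1.
  by rewrite /enorm z2 expr0n addr0 sqrtr_sqr gtr0_norm ?divff ?gt_eqF.
by rewrite acos1 oppr0.
Qed.

(** If a and b are square roots of z and w in a common quadrant, then
    |a - b| <= |a + b|, so |a - b|^2 <= |a - b| |a + b| = |z - w|. The
    hypothesis on second coordinates keeps z and w on one side of the cut. *)
Lemma omega_same_side z w : (0 <= z.2 /\ 0 <= w.2) \/ (z.2 < 0 /\ w.2 < 0) ->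
  (z.1 - w.1) ^+ 2 + (z.2 - w.2) ^+ 2 <= 1 ->
  `|(omega z).1 - (omega w).1| <= 1 /\ `|(omega z).2 - (omega w).2| <= 1.
Proof.
move=> side zw; case: (omegaP z) (omegaP w) => + + + + [].
move: (omega z) (omega w) => [u v] [u' v'] /= z1 z2 u0 vs w1 w2 u'0 v's.
set a := u - u'; set b := v - v'; set s := u + u'; set t := v + v'.
have as_ : a ^+ 2 <= s ^+ 2 by rewrite /a /s; nra.
have bt : b ^+ 2 <= t ^+ 2.
  have vv' : 0 <= v * v'.
    case: side => -[zs ws].
      by rewrite zs in vs; rewrite ws in v's; rewrite mulr_ge0.
    rewrite leNgt zs /= in vs; rewrite leNgt ws /= in v's; nra.
  by rewrite /b /t; nra.
have E : (a ^+ 2 + b ^+ 2) * (s ^+ 2 + t ^+ 2) <= 1.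
  apply: le_trans zw; rewrite -z1 -z2 -w1 -w2 /a /b /s /t le_eqVlt.
  by apply/orP; left; apply/eqP; ring.
have a2 : 0 <= a ^+ 2 by exact: sqr_ge0.
have b2 : 0 <= b ^+ 2 by exact: sqr_ge0.
(* The product above dominates the square of a^2 + b^2. *)
have ab : a ^+ 2 + b ^+ 2 <= 1.
  rewrite leNgt; apply/negP => ab.
  have : 1 < (a ^+ 2 + b ^+ 2) * (s ^+ 2 + t ^+ 2) by nra.
  by rewrite ltNge E.
have sq1 c : c ^+ 2 <= 1 -> `|c| <= 1 :> R.
  by move=> c2; rewrite -ler_sqr ?nnegrE // expr1n real_normK ?num_real.
by split; apply: sq1; lra.
Qed.

(** A change of size t of a complex number of modulus comparable to w changes
    its square by at most a multiple of t (t + w), which is bounded once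
    t (1 + w) is. *)
Lemma square_perturb (u v u' v' w t K : R) :
  0 <= w -> t * (1 + w) <= K -> `|u| <= w + 2 -> `|v| <= w + 2 ->
  `|u - u'| <= t -> `|v - v'| <= t ->
  `|(u ^+ 2 - v ^+ 2) - (u' ^+ 2 - v' ^+ 2)| <= 2 * K ^+ 2 + 8 * K /\
  `|2 * u * v - 2 * u' * v'| <= 2 * K ^+ 2 + 8 * K.
Proof.
move=> w0 tK uw vw ua vb.
have t0 : 0 <= t := le_trans (normr_ge0 _) ua.
have t_K : t <= K by nra.
have t2 : t ^+ 2 <= K ^+ 2 by nra.
have mulle (x y X Y : R) : `|x| <= X -> `|y| <= Y -> `|x * y| <= X * Y.
  by move=> xX yY; rewrite normrM ler_pM.
set a := u - u' in ua *; set b := v - v' in vb *.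
have au := mulle _ _ _ _ ua uw; have bv := mulle _ _ _ _ vb vw.
have av := mulle _ _ _ _ ua vw; have bu := mulle _ _ _ _ vb uw.
have aa := mulle _ _ _ _ ua ua; have bb := mulle _ _ _ _ vb vb.
have ab := mulle _ _ _ _ ua vb.
(* Expanding around (u, v) leaves only products of quantities bounded above by
   assumption. *)
have -> : (u ^+ 2 - v ^+ 2) - (u' ^+ 2 - v' ^+ 2) =
  2 * (a * u) - a * a - 2 * (b * v) + b * b by rewrite /a /b; ring.
have -> : 2 * u * v - 2 * u' * v' = 2 * (a * v) + 2 * (b * u) - 2 * (a * b).
  by rewrite /a /b; ring.
move: au bv av bu aa bb ab; rewrite !ler_norml.
move: (a * u) (b * v) (a * v) (b * u) (a * a) (b * b) (a * b) => x1 x2 x3 x4 x5 x6 x7.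
have tw : t * (w + 2) <= 2 * K by nra.
by move: (t * (w + 2)) tw => T tw *; split; nra.
Qed.
End Geometry.

(** * Cells close to a dual edge *)

Lemma dual_edge_ends e : nearest (val (left_site e)).1 (val (right_site e)).1.
Proof.
case: e => [[a c] /= ac].
have ca : adj c a by rewrite adjC.
change (nearest (right_site_raw c a).1 (right_site_raw a c).1).
rewrite !right_site_raw_tail /corner /=.
case: a c {ca} ac => [[i j] b] [[k l] b'] /andP[/nearestP /= nac _] /=.
case: (right_posE i j) => r1 r2 r3 r4; rewrite /nearest.
have [_ s2 _ _] := right_posE (i + 1) j; rewrite addrK in s2.
have [s1 _ _ _] := right_posE (i - 1) j; rewrite subrK in s1.
have [_ _ _ s4] := right_posE i (j + 1); rewrite addrK in s4.
have [_ _ s3 _] := right_posE i (j - 1); rewrite subrK in s3.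
case: nac => [[-> ->]|[-> ->]|[-> ->]|[-> ->]];
  rewrite ?(r1, r2, r3, r4) ?(s1, s2, s3, s4) /=; lia.
Qed.

Section Near.
Variable R : realType.
Implicit Types (z w : R * R).

Lemma dchi1E (e : dM1) :
  let p := (val (left_site e)).1 in let q := (val (right_site e)).1 in
  @dchi1 R e = [set (p.1%:~R + t * (q.1%:~R - p.1%:~R),
                     p.2%:~R + t * (q.2%:~R - p.2%:~R)) | t in [set t | 0 < t < 1]].
Proof. by []. Qed.

Lemma dchi1_nonempty (e : dM1) : @dchi1 R e !=set0.
Proof. by eexists; exists 2^-1 => //=; lra. Qed.

(** In particular the second coordinates are all >= 0 or all < 0, so a dual
    edge never jumps across the cut of omega, even if it ends on the cut or
    lies along it. *)
Lemma dchi1_strip (e : dM1) : exists k : int, forall z, @dchi1 R e z ->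
  k%:~R <= z.2 < k%:~R + 1.
Proof.
rewrite dchi1E; have := dual_edge_ends e.
case: (val (left_site e)) (val (right_site e)) => [[x y] b] [[x' y'] b'] /=.
move=> /nearestP[[-> ->]|[-> ->]|[-> ->]|[-> ->]].
- exists y => z [t /= /andP[t0 t1] <-] /=.
  by rewrite subrr mulr0 addr0 lexx ltrDl ltr01.
- exists y => z [t /= /andP[t0 t1] <-] /=.
  by rewrite subrr mulr0 addr0 lexx ltrDl ltr01.
- exists y => z [t /= /andP[t0 t1] <-] /=; rewrite rmorphD /=.
  by apply/andP; split; nra.
- exists (y - 1) => z [t /= /andP[t0 t1] <-] /=; rewrite rmorphB /=.
  by apply/andP; split; nra.
Qed.

Lemma dchi1_diam (e : dM1) z w : @dchi1 R e z -> @dchi1 R e w ->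
  (z.1 - w.1) ^+ 2 + (z.2 - w.2) ^+ 2 <= 1.
Proof.
rewrite dchi1E; have := dual_edge_ends e.
case: (val (left_site e)) (val (right_site e)) => [[x y] b] [[x' y'] b'] /=.
move=> adjP [t /= /andP[t0 t1] <-] [t' /= /andP[t'0 t'1] <-] /=.
by move: adjP => /nearestP[[-> ->]|[-> ->]|[-> ->]|[-> ->]];
  rewrite ?rmorphD ?rmorphB /=; nra.
Qed.

Lemma dchi1_omega_near (e : dM1) z w : @dchi1 R e z -> @dchi1 R e w ->
  `|(omega z).1 - (omega w).1| <= 1 /\ `|(omega z).2 - (omega w).2| <= 1.
Proof.
move=> ez ew; apply: omega_same_side; last exact: dchi1_diam ew.
have [k kP] := dchi1_strip e.
have /andP[z1 z2] := kP _ ez; have /andP[w1 w2] := kP _ ew.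
have [k0|k0] := lerP 0 k.
  by left; split; [apply: le_trans z1|apply: le_trans w1]; rewrite ler0z.
have k1 : k%:~R + 1 <= 0 :> R by rewrite -[1]/(1%:~R) -rmorphD /= lerz0; lia.
by right; split; [apply: lt_le_trans z2 _|apply: lt_le_trans w2 _].
Qed.

Lemma normW_ge0 (A : set (R * R)) : A !=set0 -> 0 <= normW A.
Proof.
move=> [z Az]; apply: lb_le_inf; first by exists (enorm (omega z)), z.
by move=> _ [w _ <-]; exact: enorm_ge0.
Qed.

Lemma dist_le (A B : set (R * R)) z w : A z -> B w ->
  dist A B <= enorm (z.1 - w.1, z.2 - w.2).
Proof.
move=> Az Bw; apply: ge_inf; last by exists z => //; exists w.
by exists 0 => _ [x _ [y _ <-]]; exact: enorm_ge0.
Qed.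

(** The decay of the Green's function is controlled by the quantity bounded
    here: when it is at least K, the differential of G(., p) at e is at most
    C / (1 + K). *)
Definition omega_close (K : R) (e : dM1) (p : dM0) : Prop :=
  (1 + normW (@dchi1 R e)) * distW (@dchi1 R e) (@dchi0 R p) < K.

(** Some point z of e satisfies |omega z - omega p| (1 + |e|_W) < K. This
    bounds the W-distance at once. Moreover omega varies by at most 1 in each
    coordinate along e, so |omega z| is comparable to |e|_W, and squaring
    bounds the Euclidean distance too (square_perturb). *)
Lemma omega_close_point K (e : dM1) (p : dM0) : omega_close K e p ->
  exists2 z, @dchi1 R e z & let w := omega (@site_pos R p.1) in
  [/\ `|(omega z).1 - w.1| <= K, `|(omega z).2 - w.2| <= K,
      `|z.1 - (@site_pos R p.1).1| <= 2 * K ^+ 2 + 8 * K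
    & `|z.2 - (@site_pos R p.1).2| <= 2 * K ^+ 2 + 8 * K].
Proof.
rewrite /omega_close; set N := normW _ => eK.
have [x0 ex0] := dchi1_nonempty e.
have N0 : 0 <= N by exact: normW_ge0 (dchi1_nonempty e).
have N1 : 0 < 1 + N by lra.
have [x1 ex1 x1N] : exists2 x, @dchi1 R e x & enorm (omega x) < N + 1.
  have [||_ [x ex <-] xN] := @inf_lt _ [set enorm (omega x) | x in @dchi1 R e] (N + 1).
  - by exists (enorm (omega x0)), x0.
  - by rewrite -/(normW _) -/N; lra.
  - by exists x.
set w := omega _.
have [z ez zp] : exists2 z, @dchi1 R e z &
    enorm ((omega z).1 - w.1, (omega z).2 - w.2) < K / (1 + N).
  have [||_ [_ [x ex <-] [_ [_ -> <-] <-]] xK] := @inf_lt _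
    [set enorm (x.1 - x'.1, x.2 - x'.2) | x in @omega R @` @dchi1 R e &
       x' in @omega R @` @dchi0 R p] (K / (1 + N)).
  - exists (enorm ((omega x0).1 - w.1, (omega x0).2 - w.2)).
    exists (omega x0); first by exists x0.
    by exists w => //; exists (@site_pos R p.1).
  - by rewrite ltr_pdivlMr // mulrC.
  - by exists x.
exists z => //=; set t := K / (1 + N) in zp.
have [zw1 zw2] := norm_le_enorm ((omega z).1 - w.1, (omega z).2 - w.2).
have {}zw1 := le_trans zw1 (ltW zp); have {}zw2 := le_trans zw2 (ltW zp).
have tN : t * (1 + N) <= K by rewrite divfK ?gt_eqF.
have t0 : 0 <= t := le_trans (normr_ge0 _) zw1.
have tK : t <= K by nra.
have [x1_1 x1_2] := norm_le_enorm (omega x1).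
have [d1 d2] := dchi1_omega_near ez ex1.
have u2 : `|(omega z).1| <= N + 2.
  rewrite -[(omega z).1](subrK (omega x1).1) (le_trans (ler_normD _ _)) //.
  rewrite /= in x1_1; lra.
have v2 : `|(omega z).2| <= N + 2.
  rewrite -[(omega z).2](subrK (omega x1).2) (le_trans (ler_normD _ _)) //.
  rewrite /= in x1_2; lra.
have [s1 s2] := square_perturb N0 tN u2 v2 zw1 zw2.
have [Ez1 Ez2 _ _] := omegaP z; have [Ew1 Ew2 _ _] := omegaP (@site_pos R p.1).
rewrite Ez1 Ew1 in s1; rewrite Ez2 Ew2 in s2.
by split=> //; [apply: le_trans tK|apply: le_trans tK].
Qed.

Lemma omega_close_both K (e : dM1) (p q : dM0) : omega_close K e p -> omega_close K e q ->
  let x := @site_pos R p.1 in let y := @site_pos R q.1 in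
  enorm (x.1 - y.1, x.2 - y.2) <= 8 * K ^+ 2 + 32 * K + 2 /\
  enorm ((omega x).1 - (omega y).1, (omega x).2 - (omega y).2)
    <= 8 * K ^+ 2 + 32 * K + 2.
Proof.
move=> /omega_close_point[z ez [a1 a2 a3 a4]].
move=> /omega_close_point[w ew [b1 b2 b3 b4]]; cbv zeta.
have K0 : 0 <= K := le_trans (normr_ge0 _) a1.
have K2 : 0 <= K ^+ 2 := sqr_ge0 _.
have [c1 c2] := dchi1_omega_near ez ew.
have zw := dchi1_diam ez ew.
have sq1 c : c ^+ 2 <= 1 -> `|c| <= 1 :> R.
  by move=> cc; rewrite -ler_sqr ?nnegrE // expr1n real_normK ?num_real.
have c3 : `|z.1 - w.1| <= 1 by apply: sq1; have := sqr_ge0 (z.2 - w.2); lra.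
have c4 : `|z.2 - w.2| <= 1 by apply: sq1; have := sqr_ge0 (z.1 - w.1); lra.
move: a1 a2 a3 a4 b1 b2 b3 b4 c1 c2 c3 c4.
move: (omega (@site_pos R p.1)) (omega (@site_pos R q.1)) (omega z) (omega w).
move: (@site_pos R p.1) (@site_pos R q.1).
have bound (r s x y A B : R) : `|x - r| <= A -> `|y - s| <= A -> `|x - y| <= B ->
    `|r - s| <= 2 * A + B.
  by rewrite !ler_norml => *; apply/andP; split; lra.
move=> P Q u v x y a1 a2 a3 a4 b1 b2 b3 b4 c1 c2 c3 c4.
split; apply: le_trans (enorm_le _) _ => /=.
- have := bound _ _ _ _ _ _ a3 b3 c3; have := bound _ _ _ _ _ _ a4 b4 c4; lra.
- have := bound _ _ _ _ _ _ a1 b1 c1; have := bound _ _ _ _ _ _ a2 b2 c2; lra.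
Qed.

End Near.

(** * Bond lengths stay strictly below one half *)

(** A crack point has a branch that reflection preserves, whereas reflection
    flips the branch of all other dual points. So if exactly one end is on the
    crack, the edge or its reflection has both ends on one branch; if neither
    is, the ends agree already. *)
Lemma dual_edge_branch e :
  [\/ on_crack (val (right_site e)).1 && on_crack (val (left_site e)).1,
      exists c, dbranch1 c e | exists c, dbranch1 c (refl1 e)].
Proof.
rewrite /dbranch1 /dbranch0 /dhead1 /dtail1 right_site_refl left_site_refl /fst.
set r := right_site e; set l := left_site e.
have refl_branch s : (val (refl_site s)).2 =
    if on_crack (val s).1 then (val s).2 else ~~ (val s).2.
  by rewrite /=; case: ifP.
have [rl|rl] := eqVneq (val r).2 (val l).2; first by apply: Or32; exists (val r).2.
case: (boolP (on_crack (val r).1)) (boolP (on_crack (val l).1)) => rc [] lc.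
- exact: Or31.
- apply: Or33; exists (val r).2; rewrite !refl_branch rc (negbTE lc); split=> //.
  by move: rl; case: (val r).2; case: (val l).2.
- apply: Or33; exists (val l).2; rewrite !refl_branch lc (negbTE rc); split=> //.
  by move: rl; case: (val r).2; case: (val l).2.
- by move: rl; rewrite (off_crack_branch rc lc) eqxx.
Qed.

(** A loop around a crack point has vertices on both branches. *)
Lemma M2plus_off_crack F : M2plus F ->
  ~~ on_crack (val F.1).1 /\ (val F.1).2 = true.
Proof.
have -> : M2plus F = all (fun a : M0 => a.2) (clockwise F.1).
  by rewrite /M2plus /loop2; case: ifP => // _; rewrite all_rev.
case: F => [[[[x y] b] ok] o]; rewrite /clockwise /=; case: ifP => // _.
by case: ifP => _; case: b {ok}.
Qed.

Section Bound.
Variable R : realType.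

Lemma site_pos_refl s : ~~ on_crack (val s).1 ->
  @site_pos R (refl_site s) = ((@site_pos R s).1, - (@site_pos R s).2).
Proof. by move=> sc; rewrite /site_pos /= (negbTE sc) /= rmorphN. Qed.

Lemma omega_site_refl s : ~~ on_crack (val s).1 ->
  omega (@site_pos R (refl_site s)) =
  ((omega (@site_pos R s)).1, - (omega (@site_pos R s)).2).
Proof.
move=> sc; rewrite site_pos_refl // omega_conj // /site_pos intr_eq0 ltr0z.
by move: sc; rewrite /on_crack; lia.
Qed.

Lemma dist_chi2_le (F E : M2) :
  let x := @site_pos R F.1 in let y := @site_pos R E.1 in
  dist (@chi2 R F) (@chi2 R E) <= enorm (x.1 - y.1, x.2 - y.2) /\
  distW (@chi2 R F) (@chi2 R E) <=
    enorm ((omega x).1 - (omega y).1, (omega x).2 - (omega y).2).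
Proof.
have posP (H : M2) : @chi2 R H (@site_pos R H.1).
  by rewrite /chi2 /= !subrr normr0 invr_gt0 ltr0n.
by move=> x y; split; apply: dist_le; [| |exists x|exists y].
Qed.

(** By symmetry of G, invariance under reflection of the first variable passes
    to the second. *)
Lemma dd0_green_refl2 (G : dM0 -> dM0 -> R) p e : is_green G ->
  dd0 (G^~ (refl2 p)) e = dd0 (G^~ p) e.
Proof.
case=> Gs Gsym _ _ _; have E q : G q (refl2 p) = G q p.
  by rewrite Gsym (Gs q).2 Gsym.
by rewrite /dd0 !E.
Qed.

Lemma green_far_small (G : dM0 -> dM0 -> R) (d : R) : is_green G -> 0 < d ->
  exists K : R, forall c e p, dbranch1 c e -> dbranch0 c p -> ~ omega_close K e p ->
    `|dd0 (G^~ p) e| <= d.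
Proof.
case=> _ _ _ [C C0 Cdecay] _ d0; exists (C / d) => c e p ce cp nn.
apply: le_trans (Cdecay c e p ce cp) _.
move/negP: nn; rewrite -leNgt; move: ((1 + _) * _) => X KX.
have CdX : C <= X * d by rewrite -ler_pdivrMr.
have K0 : 0 < C / d by rewrite divr_gt0.
have X1 : 0 < 1 + X by lra.
by rewrite ler_pdivrMr // mulrDr mulr1 [d * X]mulrC; lra.
Qed.

(** Two cells close to the same dual edge are within a bounded distance of
    each other, both in the Euclidean and in the W-sense, while separation
    requires one of the two distances to be at least eps n. Branch -1 is
    covered because reflecting two cells off the crack preserves both
    distances. *)
Lemma separated_close_unique (K eps : R) : 0 < eps ->
  exists N, forall n, (N <= n)%N -> forall m (e : 'I_m -> M2) c a i j,
    (forall i, M2plus (e i)) -> Defs.separated eps n e -> i != j ->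
    let q i := if c then e i else refl2 (e i) in
    omega_close K a (q i) -> omega_close K a (q j) -> False.
Proof.
move=> eps0; set B := 8 * K ^+ 2 + 32 * K + 2.
exists (Num.bound `|B / eps|) => n Nn m e c a i j ep sep ij q ni nj.
have Bn : B < eps * n%:R.
  rewrite mulrC -ltr_pdivrMr //; apply: le_lt_trans (ler_norm _) _.
  by apply: lt_le_trans (archi_boundP _) _; rewrite ?normr_ge0 ?ler_nat.
have [ci _] := M2plus_off_crack (ep i); have [cj _] := M2plus_off_crack (ep j).
have [d1 d2] := dist_chi2_le (e i) (e j).
have conjB (x y z : R) : enorm (x, - y - - z) = enorm (x, y - z).
  by rewrite -opprD -[RHS]enorm_conj.
have [b1 b2] : enorm ((@site_pos R (e i).1).1 - (@site_pos R (e j).1).1,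
                    (@site_pos R (e i).1).2 - (@site_pos R (e j).1).2) <= B /\
    enorm ((omega (@site_pos R (e i).1)).1 - (omega (@site_pos R (e j).1)).1,
           (omega (@site_pos R (e i).1)).2 - (omega (@site_pos R (e j).1)).2) <= B.
  have := omega_close_both ni nj; rewrite /q; case: {q ni nj} c => //.
  have E k : (refl2 (e k)).1 = refl_site (e k).1 by [].
  rewrite !E (omega_site_refl ci) (omega_site_refl cj).
  by rewrite (site_pos_refl ci) (site_pos_refl cj) !conjB.
have := sep i j ij; rewrite leNgt gt_max => /negP; apply.
apply/andP; split; apply: le_lt_trans Bn.
  exact: le_trans d1 b1.
exact: le_trans d2 b2.
Qed.

Lemma dd0_green_of (G : dM0 -> dM0 -> R) m (b : 'I_m -> R) (e : 'I_m -> M2) a :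
  dd0 (green_of G b e) a = \sum_(i < m) b i * dd0 (G^~ (e i)) a.
Proof.
by rewrite /dd0 /green_of -sumrB; apply: eq_bigr => i _; rewrite mulrBr.
Qed.

(** For large n, at most one dislocation is close to a dual edge, and it gives
    less than 1/2 - eps'. The others contribute at most eps'/2 in total, by
    decay. Decay is available after moving the edge to a single branch by
    reflection, and the dislocations to that branch; edges along the crack
    carry no differential at all. *)
Lemma green_of_bound (G : dM0 -> dM0 -> R) (eps : R) m (b : 'I_m -> R) :
  is_green G -> 0 < eps -> (forall i, `|b i| <= 1) ->
  exists2 d : R, 0 < d & exists N, forall n, (N <= n)%N ->
    forall mu e, calB eps b n mu e ->
    forall a, `|dd0 (green_of G b e) a| <= 2^-1 - d.
Proof.
move=> GP eps0 b1; have [Gs _ _ _ [d d0 Gd]] := GP.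
have {}Gd p a : `|dd0 (G^~ p) a| < 2^-1 - d.
  rewrite -lte_fin; apply: le_lt_trans (Gd p); apply: ereal_sup_ubound.
  by exists a.
(* An equal share of d/2 for each dislocation; m.+1 because m may be 0. *)
pose h := d / 2 / (m.+1)%:R.
have h0 : 0 < h by rewrite !divr_gt0 ?ltr0n.
have mh : m%:R * h <= d / 2.
  by rewrite /h mulrA ler_pdivrMr ?ltr0n // mulrC ler_pM2l ?divr_gt0 // ler_nat.
have [K Kfar] := green_far_small GP h0.
have [N Nnear] := @separated_close_unique K eps eps0.
exists (d / 2); first by rewrite divr_gt0.
exists N => n Nn mu e [_ eP sep] a.
have ep i : M2plus (e i) by case: (eP i).
(* Any pole serves: only the uniform bound on the differential matters. *)
have d_half : 0 < 2^-1 - d.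
  exact: le_lt_trans (normr_ge0 _) (Gd (left_site a, true) a).
have term i (x : R) : `|dd0 (G^~ (e i)) a| <= x -> `|b i * dd0 (G^~ (e i)) a| <= x.
  move=> ix; rewrite normrM; apply: le_trans ix.
  by rewrite -[leRHS]mul1r ler_wpM2r.
rewrite dd0_green_of; have [/andP[rc lc]|ac] : (on_crack (val (right_site a)).1 &&
    on_crack (val (left_site a)).1) \/
    exists c a', dbranch1 c a' /\ forall i, dd0 (G^~ (e i)) a' = dd0 (G^~ (e i)) a.
  case: (dual_edge_branch a) => [|[c ca]|[c ca]]; first by left.
    by right; exists c, a.
  by right; exists c, (refl1 a); split=> // i; rewrite dd0_refl.
- rewrite big1 ?normr0; first by lra.
  move=> i _; rewrite /dd0 /dhead1 /dtail1.
  by rewrite (crack_eq0 (Gs (e i)) rc) (crack_eq0 (Gs (e i)) lc) subrr mulr0.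
have {ac} [c [a' [ca' aE]]] := ac.
pose q i := if c then e i else refl2 (e i).
have qE i : dd0 (G^~ (q i)) a' = dd0 (G^~ (e i)) a.
  by rewrite /q; case: {q ca'} c; rewrite ?dd0_green_refl2.
have qc i : dbranch0 c (q i).
  have [ci bi] := M2plus_off_crack (ep i).
  by rewrite /q /dbranch0; case: {q ca' qE} c => //=; rewrite (negbTE ci) /= bi.
have far i : ~ omega_close K a' (q i) -> `|b i * dd0 (G^~ (e i)) a| <= h.
  by move=> ni; apply: term; rewrite -qE; exact: Kfar ca' (qc i) ni.
have sum_far (P : pred 'I_m) : (forall i, P i -> ~ omega_close K a' (q i)) ->
    `|\sum_(i < m | P i) b i * dd0 (G^~ (e i)) a| <= d / 2.
  move=> Pfar; apply: le_trans (ler_norm_sum _ _ _) _.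
  apply: le_trans (ler_sum _ (fun i Pi => far i (Pfar i Pi))) _.
  apply: le_trans mh; rewrite sumr_const -[h *+ _]mulr_natl ler_pM2r // ler_nat.
  by rewrite -[leqRHS]card_ord max_card.
have [[i ni]|noni] := pselect (exists i, omega_close K a' (q i)); last first.
  have -> : 2^-1 - d / 2 = d / 2 + (2^-1 - d) by lra.
  rewrite -[X in `|X|]addr0; apply: le_trans (ler_normD _ _) _.
  rewrite normr0 lerD ?(ltW d_half) //; apply: sum_far => i _ ni.
  by apply: noni; exists i.
rewrite (bigD1 i) //=; apply: le_trans (ler_normD _ _) _.
have -> : 2^-1 - d / 2 = (2^-1 - d) + d / 2 by lra.
apply: lerD; first by apply: term; exact/ltW.
apply: sum_far => j ji nj.
by apply: (Nnear n Nn m e c a' j i).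
Qed.

End Bound.

(** * Stability *)

Section Energy.
Variable R : realType.
Implicit Types (y : M0 -> R) (alpha beta : M1 -> R).

Lemma distZE (x t : R) : `|t| <= 2^-1 -> t - x \is a Num.int -> distZ x = `|t|.
Proof.
move=> t2 /intrP[k xk]; apply/eqP; rewrite eq_le; apply/andP; split.
  apply: ge_inf; first by exists 0 => _ [z _ <-].
  (* t = x + k, so |t| is the distance from x to - k. *)
  exists (- k) => //; rewrite mulrNz opprK -xk; congr `|_|; ring.
apply: lb_le_inf; first by exists `|x - 0%:~R|, 0.
move=> _ [z _ <-]; have [E|kz] := eqVneq (k + z) 0.
  have -> : x - z%:~R = t - (k + z)%:~R by rewrite intrD -xk; ring.
  by rewrite E subr0.
(* Any other integer z shifts t by a nonzero integer, which moves it at least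
   1/2 away from 0. *)
have kz1 : 1 <= `|(k + z)%:~R| :> R.
  by rewrite -intr_norm -[1]/(1%:~R) ler_int; lia.
have -> : x - z%:~R = t - (k + z)%:~R by rewrite intrD -xk; ring.
rewrite distrC; apply: le_trans (lerB_dist _ _); lra.
Qed.

Lemma L2norm_ge alpha e : (`|alpha e|%:E <= L2norm alpha)%E.
Proof.
have -> : (`|alpha e|%:E = sqrte ((alpha e ^+ 2)%:E))%E.
  by rewrite /sqrte sqrtr_sqr.
rewrite lee_sqrt; last by apply: esum_ge0 => x _; rewrite lee_fin sqr_ge0.
apply: esum_ge; exists [set e]; last by rewrite fsbig_set1.
by split; [exact: finite_set1 | ].
Qed.

Lemma fsum_seq (T : choiceType) (r : seq T) (f : T -> R) :
  uniq r -> (forall i, i \notin r -> f i = 0) ->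
  \sum_(i \in [set: T]) f i = \sum_(i <- r) f i.
Proof.
move=> ur f0; rewrite (fsbigE r) //; last by move=> i _; exact: f0.
by apply: eq_bigl => i; rewrite in_setT.
Qed.

Lemma flatten_in_edges_uniq (X : seq M0) :
  uniq X -> uniq (flatten [seq in_edges a | a <- X]).
Proof.
elim: X => //= a X IHX /andP[aX uX]; rewrite cat_uniq in_edges_uniq IHX // andbT.
apply/hasPn => e /flatten_mapP[c cX]; rewrite !mem_in_edges => /eqP ec.
by apply: contraNN aX => /eqP <-; rewrite ec.
Qed.

(** Summation by parts in finite form: the edges with an end in the support of
    y are those entering it and their reversals, and grouping the former by
    head turns the sum of beta times y at the head into a sum of
    y(a) delta beta(a). *)
Lemma incident_edges y : finite_set [set a | y a != 0] -> exists r : seq M1,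
  [/\ uniq r, perm_eq (map opp1 r) r,
      forall e, e \notin r -> y (head1 e) = 0 /\ y (tail1 e) = 0
    & forall beta, delta1 beta = (fun=> 0) ->
        \sum_(e <- r) beta e * y (head1 e) = 0].
Proof.
move=> /finite_seqP[X0 yX0]; pose X := undup X0.
have yX a : a \notin X -> y a = 0.
  rewrite mem_undup => aX; apply/eqP/negPn/negP => ya.
  have : [set a | y a != 0] a by [].
  by rewrite yX0 /= (negbTE aX).
pose r0 := flatten [seq in_edges a | a <- X].
have ur0 : uniq r0 by exact/flatten_in_edges_uniq/undup_uniq.
have r0P e : (e \in r0) = (head1 e \in X).
  apply/flatten_mapP/idP => [[a aX]|eX].
    by rewrite mem_in_edges => /eqP ->.
  by exists (head1 e); rewrite ?mem_in_edges.
pose r := undup (r0 ++ map opp1 r0).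
have rP e : (e \in r) = (head1 e \in X) || (tail1 e \in X).
  rewrite mem_undup mem_cat -{2}(opp1K e) (mem_map (can_inj opp1K)) !r0P.
  by [].
exists r; split.
- exact: undup_uniq.
- apply: uniq_perm; rewrite ?(map_inj_uniq (can_inj opp1K)) ?undup_uniq // => e.
  rewrite -{1}(opp1K e) (mem_map (can_inj opp1K)) !rP orbC.
  by [].
- by move=> e; rewrite rP negb_or => /andP[/yX -> /yX ->].
- move=> beta beta0; rewrite -(@fsum_seq _ r) ?undup_uniq //; last first.
    by move=> e; rewrite rP negb_or => /andP[/yX -> _]; rewrite mulr0.
  rewrite (@fsum_seq _ r0) //; last first.
    by move=> e; rewrite r0P => /yX ->; rewrite mulr0.
  rewrite big_flatten big_map big1 // => a _.
  transitivity (delta1 beta a * y a); last by rewrite beta0 mul0r.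
  rewrite delta1E mulr_suml; apply: eq_big_seq => e.
  by rewrite mem_in_edges => /eqP ->.
Qed.

(** Since alpha stays d below 1/2, a perturbation z with |dz| <= d never
    reaches the kink of psi, so the change of energy is exactly the sum of
    lambda/2 (2 alpha dz + dz^2). The linear part is a multiple of the pairing
    of delta alpha with z, which vanishes. *)
Lemma locally_stable_coclosed (lambda d : R) y alpha :
  0 < lambda -> 0 < d -> Vs0 y -> (forall e, alpha (opp1 e) = - alpha e) ->
  delta1 alpha = (fun=> 0) -> (forall e, `|alpha e| <= 2^-1 - d) ->
  (forall e, alpha e - d0 y e \is a Num.int) -> locally_stable lambda y.
Proof.
move=> l0 d_gt0 ys alpha_odd coclosed alpha_le alpha_y; split=> //.
exists d => // z [zs /incident_edges[r [ur opp_r r0 by_parts]]] zd.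
have dz e : `|d0 z e| <= d.
  by rewrite -lee_fin; exact: le_trans (L2norm_ge (d0 z) e) zd.
have diffE e : psi lambda (d0 (fun a => y a + z a) e) - psi lambda (d0 y e) =
    lambda / 2 * (2 * (alpha e * d0 z e) + d0 z e ^+ 2).
  have d0D : d0 (fun a => y a + z a) e = d0 y e + d0 z e by rewrite /d0; ring.
  have a_le := alpha_le e; have z_le := dz e.
  have a_y := alpha_y e.
  rewrite /psi d0D (@distZE (d0 y e) (alpha e)) //; last by lra.
  rewrite (@distZE (d0 y e + d0 z e) (alpha e + d0 z e)).
  - by rewrite !real_normK ?num_real //; ring.
  - by apply: le_trans (ler_normD _ _) _; lra.
  - by rewrite (_ : _ - _ = alpha e - d0 y e) //; ring.
rewrite /energy (@fsum_seq _ r) //; last first.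
  move=> e /r0[h t]; rewrite diffE (_ : d0 z e = 0); first by ring.
  by rewrite /d0 h t subrr.
under eq_bigr do rewrite diffE.
rewrite -mulr_sumr big_split /= -mulr_sumr.
have -> : \sum_(e <- r) alpha e * d0 z e = 0.
  under eq_bigr do rewrite mulrBr.
  (* Reversing edges exchanges heads and tails, so both halves of dz
     vanish. *)
  rewrite sumrB by_parts // sub0r -(perm_big _ opp_r) big_map /=.
  under eq_bigr do rewrite alpha_odd mulNr.
  by rewrite sumrN opprK by_parts.
rewrite mulr0 add0r; apply: mulr_ge0; first by rewrite divr_ge0 ?ltW.
by apply: sumr_ge0 => e _; exact: sqr_ge0.
Qed.

End Energy.

(** * Existence of the equilibrium *)

Theorem theorem4p3 (R : realType) (lambda eps : R) (m : nat) (b : 'I_m -> R)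
    (G : dM0 -> dM0 -> R)
    (lambda_gt0 : 0 < lambda) (eps_gt0 : 0 < eps)
    (bP : forall i, b i = 1 \/ b i = -1)
    (GP : is_green G) :
  exists N : nat, forall n : nat, (N <= n)%N ->
    forall (mu : M2 -> R) (e : 'I_m -> M2), calB eps b n mu e ->
      exists y : M0 -> R, locally_stable lambda y /\
        exists alpha : M1 -> R,
          [/\ bond_lengths y alpha,
              d1 alpha = mu,
              delta1 alpha = (fun=> 0),
              dVs0 (green_of G b e)
            & star_form1 alpha = dd0 (green_of G b e)].
Proof.
have b1 i : `|b i| <= 1 by case: (bP i) => ->; rewrite ?normrN normr1.
have [d d0 [N alpha_bound]] := green_of_bound GP eps_gt0 b1.
exists N => n Nn mu e muB; have alpha_le := alpha_bound n Nn mu e muB.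
have [Gs _ Geq _ _] := GP; set alpha := dd0 (green_of G b e) in alpha_le *.
have Gbs : dVs0 (green_of G b e).
  split=> p; rewrite /green_of -?sumrN; apply: eq_bigr => i _.
    by rewrite (Gs _).1 mulrN.
  by rewrite (Gs _).2.
have alpha_odd e' : alpha (opp1 e') = - alpha e' by exact: dd0_opp.
have alpha_s : Vs1 alpha by split=> // e'; exact: dd0_refl.
have d_alpha : d1 alpha = mu.
  have [-> _ _] := muB; apply: funext => F.
  rewrite d1_ddelta1 // ddelta1E; under eq_bigr do rewrite /alpha dd0_green_of.
  rewrite exchange_big mulr_sumr; apply: eq_bigr => i _.
  by rewrite -mulr_sumr mulrCA -(ddelta1E (dd0 (G^~ (e i)))) Geq.
have coclosed : delta1 alpha = (fun=> 0) by exact: delta1_dd0.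
have alpha_int F : d1 alpha F \is a Num.int.
  rewrite d_alpha; have [-> _ _] := muB; apply: rpred_sum => i _.
  apply: rpredM; first by case: (bP i) => ->; rewrite ?rpredN rpred1.
  by apply: rpredD; apply: rpredB; exact: natr_int.
have [y ys y_alpha] := potential_mod_int alpha_s alpha_int.
exists y; split.
  exact: (locally_stable_coclosed lambda_gt0 d0 ys alpha_odd coclosed alpha_le y_alpha).
exists alpha; split=> //; split=> //.
apply: ge_ereal_sup => _ [e' _ <-]; rewrite lee_fin.
by apply: le_trans (alpha_le e') _; lra.
Qed.
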